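(* Let $[a,b]$, $\alpha$, $\beta$, $A$ be as in the context. For any integrable functions $x,y:[a,b]\to\mathbb{R}$ (for which the two integrals below are defined), the following duality relation holds: $$\int_a^b x(t)\,\bigl({}^{A}I^{\alpha,\beta}_{a+}y\bigr)(t)\,dt=\int_a^b y(t)\,\bigl({}^{A}I^{\alpha,\beta}_{b-}x\bigr)(t)\,dt.$$
   Context: Let $[a,b]$ be a real interval, $\alpha\in[0,1]$ a real parameter, $\beta$ a complex parameter with non-negative real part, and $R$ a positive number with $R>(b-a)^{\mathrm{Re}(\beta)}$. Let $A$ be a complex analytic function on the disc $D(0,R)$, given there by the locally uniformly convergent power series $A(x)=\sum_{n=0}^{\infty}a_nx^n$. The left and right-sided fractional integrals with general analytic kernel of a function $x:[a,b]\to\mathbb{R}$ are $${}^{A}I^{\alpha,\beta}_{a+}x(t)=\int_a^t(t-s)^{\alpha-1}A\bigl((t-s)^{\beta}\bigr)x(s)\,ds,\qquad {}^{A}I^{\alpha,\beta}_{b-}x(t)=\int_t^b(s-t)^{\alpha-1}A\bigl((s-t)^{\beta}\bigr)x(s)\,ds.$$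
   Formalization: ''For which the two integrals are defined'' is taken to mean that both iterated integrals converge absolutely; if only the inner integrals exist and the outer integrands are integrable, the duality fails already for A = 1 and 0 < α < 1. *)

(* Defs.v *)
(* MathComp / MathComp-Analysis, with complex numbers R[i] from real-closed. *)
From HB Require Import structures.
From mathcomp Require Import all_boot all_order all_algebra.
From mathcomp Require Import complex.
From mathcomp Require Import all_classical all_reals all_analysis.

Set Implicit Arguments.
Unset Strict Implicit.
Unset Printing Implicit Defensive.

Import Order.TTheory GRing.Theory Num.Theory.
Import numFieldNormedType.Exports.
Import ComplexField.Normc.

Local Open Scope classical_set_scope.
Local Open Scope ring_scope.
Local Open Scope complex_scope.

(* A is the sum of the power series with coefficients c on the open disc
   D(0, rho), the partial sums converging locally uniformly there; the values
   of A outside the disc are irrelevant. Used below with K = R[i]. *)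
Definition power_series_on_disc (K : numFieldType) (rho : K) (c : nat -> K)
    (A : K -> K) : Prop :=
  forall z0 : K, `|z0| < rho ->
    exists2 V : set K, nbhs z0 V &
      {uniform V, (fun (n : nat) (z : K) => \sum_(0 <= k < n) c k * z ^+ k)
         @ \oo --> A}.

(* Principal power u ^ beta = exp (beta * ln u) of a real number u > 0. The
   value at u = 0 is a convention and only matters on null sets below. *)
Definition cpowR (R : realType) (u : R) (beta : R[i]) : R[i] :=
  (u `^ complex.Re beta)%:C
    * (cos (complex.Im beta * ln u) +i* sin (complex.Im beta * ln u)).

Definition analytic_kernel (R : realType) (alpha : R) (beta : R[i])
    (A : R[i] -> R[i]) (u : R) : R[i] :=
  (u `^ (alpha - 1))%:C * A (cpowR u beta).

(* Lebesgue integral of a complex-valued function. *)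
Definition Cintegral (R : realType) (D : set R) (f : R -> R[i]) : R[i] :=
  (\int[lebesgue_measure]_(t in D) complex.Re (f t))
    +i* (\int[lebesgue_measure]_(t in D) complex.Im (f t)).

Definition left_frac_integral (R : realType) (a : R) (alpha : R) (beta : R[i])
    (A : R[i] -> R[i]) (x : R -> R) (t : R) : R[i] :=
  Cintegral `[a, t]
    (fun s => analytic_kernel alpha beta A (t - s) * (x s)%:C).

Definition right_frac_integral (R : realType) (b : R) (alpha : R) (beta : R[i])
    (A : R[i] -> R[i]) (x : R -> R) (t : R) : R[i] :=
  Cintegral `[t, b]
    (fun s => analytic_kernel alpha beta A (s - t) * (x s)%:C).

(* The iterated integrals of x * (left integral of y) and of
   y * (right integral of x) are defined when they converge absolutely.
   Asking only that the inner integrals, and then the outer integrands, be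
   Lebesgue integrable is not enough for the duality: it fails already for
   A = 1 and 0 < alpha < 1. *)
Definition left_pairing_defined (R : realType) (a b alpha : R) (beta : R[i])
    (A : R[i] -> R[i]) (x y : R -> R) : Prop :=
  (\int[lebesgue_measure]_(t in `[a, b]) \int[lebesgue_measure]_(s in `[a, t])
     (normc ((x t)%:C * (analytic_kernel alpha beta A (t - s) * (y s)%:C)))%:E
   < +oo)%E.

Definition right_pairing_defined (R : realType) (a b alpha : R) (beta : R[i])
    (A : R[i] -> R[i]) (x y : R -> R) : Prop :=
  (\int[lebesgue_measure]_(t in `[a, b]) \int[lebesgue_measure]_(s in `[t, b])
     (normc ((y t)%:C * (analytic_kernel alpha beta A (s - t) * (x s)%:C)))%:E
   < +oo)%E.

(* Main.v *)
(* Over the triangle a <= s <= t <= b both sides integrate the same function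
   x(t) K(t - s) y(s), once along rows and once along columns. The kernel K is
   measurable on [0, b - a], being there a pointwise limit of polynomials in
   the principal power: |u ^ beta| <= (b - a) ^ Re beta < rho. So by Tonelli
   the absolute convergence of one iterated integral gives integrability on
   the triangle, and Fubini applies to the real and imaginary parts. *)

Require Import Defs.
From HB Require Import structures.
From mathcomp Require Import all_boot all_order all_algebra.
From mathcomp Require Import complex.
From mathcomp Require Import all_classical all_reals all_analysis.
From mathcomp Require Import measurable_realfun.

Set Implicit Arguments.
Unset Strict Implicit.
Unset Printing Implicit Defensive.

Import Order.TTheory GRing.Theory Num.Theory.
Import numFieldNormedType.Exports.

Local Open Scope classical_set_scope.
Local Open Scope ring_scope.
Local Open Scope complex_scope.

(** * The real-valued integral of functions that need not be integrable *)

Section real_integration.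
Context d (T : measurableType d) (R : realType) (mu : {measure set T -> \bar R}).

(* [fine] sends both infinities to 0, and [+oo - +oo = -oo]. *)
Lemma Rintegral_nonintegrable (D : set T) (f : T -> R) : measurable D ->
  measurable_fun D f -> ~ mu.-integrable D (EFin \o f) ->
  \int[mu]_(x in D) f x = 0.
Proof.
move=> mD mf nf; rewrite /Rintegral integralE.
have /measurable_EFinP mEf := mf.
have p0 := @integral_ge0 _ _ _ mu D (EFin \o f)^\+%E (fun x _ => funepos_ge0 _ x).
have n0 := @integral_ge0 _ _ _ mu D (EFin \o f)^\-%E (fun x _ => funeneg_ge0 _ x).
(* A finite sum here would be integrability. Both terms are non-negative, so at least one is +oo,
   and their difference is infinite in every case. *)
have : (\int[mu]_(x in D) (EFin \o f)^\+ x
        + \int[mu]_(x in D) (EFin \o f)^\- x = +oo)%E.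
  apply/eqP/negPn/negP => neqoo; apply: nf; apply/integrableP; split => //.
  rewrite -[X in (X < _)%E]/(\int[mu]_(x in D) (abse \o (EFin \o f)) x)%E fune_abse.
  rewrite ge0_integralD//; first by rewrite ltey.
  - exact: measurable_funepos.
  - exact: measurable_funeneg.
by move: p0 n0; case: (integral _ _ _) => [p| |] //; case: (integral _ _ _).
Qed.

(** For k <> 0, k f is integrable exactly when f is, so without integrability both sides are 0 by
    convention. This lets a factor cross the inner integral for every value of the outer variable,
    even where that integral diverges. *)
Lemma RintegralZl_measurable (D : set T) (f : T -> R) (k : R) : measurable D ->
  measurable_fun D f ->
  \int[mu]_(x in D) (k * f x) = k * \int[mu]_(x in D) f x.
Proof.
move=> mD mf; have [->|k0] := eqVneq k 0.
  rewrite mul0r; under eq_Rintegral do rewrite mul0r.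
  by rewrite Rintegral_cst// mul0r.
have [fi|fni] := pselect (mu.-integrable D (EFin \o f)); first exact: RintegralZl.
rewrite (Rintegral_nonintegrable mD mf fni) mulr0 Rintegral_nonintegrable//.
  exact: measurable_funM.
move=> kfi; apply: fni.
have := integrableZl mD k^-1 kfi.
apply: eq_integrable => // t _ /=.
by rewrite -EFinM mulrA mulVf// mul1r.
Qed.

End real_integration.

(** * Fubini for real-valued iterated integrals *)

Section real_fubini.
Context d1 d2 (T1 : measurableType d1) (T2 : measurableType d2) (R : realType).
Variables (m1 : {sigma_finite_measure set T1 -> \bar R})
  (m2 : {sigma_finite_measure set T2 -> \bar R}) (f : T1 * T2 -> R).
Hypothesis fi : (m1 \x m2)%E.-integrable setT (EFin \o f).

(** The real inner integral is [fine] of the extended one, and the two agree where the section is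
    integrable. That is almost every x, which suffices for the outer integral. *)
Lemma Rintegral_fubini1 :
  \int[m1]_x \int[m2]_y f (x, y) = fine (\int[m1]_x \int[m2]_y (f (x, y))%:E)%E.
Proof.
have mF := measurable_fubini_F fi.
congr fine; apply: ae_eq_integral => //.
  apply/measurable_EFinP.
  exact: (measurableT_comp _ mF).
apply: filterS (ae_integrable1 fi) => x xi _.
by rewrite /Rintegral fineK//; exact: integrable_fin_num xi.
Qed.

Lemma Rintegral_fubini2 :
  \int[m2]_y \int[m1]_x f (x, y) = fine (\int[m2]_y \int[m1]_x (f (x, y))%:E)%E.
Proof.
have mG := measurable_fubini_G fi.
congr fine; apply: ae_eq_integral => //.
  apply/measurable_EFinP.
  exact: (measurableT_comp _ mG).
apply: filterS (ae_integrable2 fi) => y yi _.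
by rewrite /Rintegral fineK//; exact: integrable_fin_num yi.
Qed.

Lemma Rintegral_fubini :
  \int[m1]_x \int[m2]_y f (x, y) = \int[m2]_y \int[m1]_x f (x, y).
Proof. by rewrite Rintegral_fubini1 Rintegral_fubini2; congr fine; exact: Fubini fi. Qed.

End real_fubini.

(** * Integration over the triangle of points (t, s) with a <= s <= t <= b *)

Definition triangle (R : realType) (a b : R) : set (R * R) :=
  [set p | [/\ a <= p.2, p.2 <= p.1 & p.1 <= b]].

Section triangle.
Context (R : realType) (a b : R).
Local Notation mu := (@lebesgue_measure R).
Implicit Types (x y k : R -> R).

Lemma measurable_triangle : measurable (triangle a b).
Proof.
rewrite (_ : triangle a b = (setT `&` [set p | a <= p.2]) `&`
  ((setT `&` [set p | p.2 <= p.1]) `&` (setT `&` [set p | p.1 <= b]))).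
  by apply: measurableI; [|apply: measurableI]; apply: measurable_fun_le.
by rewrite !setTI; apply/seteqP; split => [p [? ? ?]|p [? [? ?]]].
Qed.

(** Each factor is measurable only on its own interval, so each composition rests on the triangle
    being mapped into that interval by t, s or t - s. *)
Lemma measurable_fun_kernel_triangle x y k :
  measurable_fun `[a, b] x -> measurable_fun `[a, b] y ->
  measurable_fun `[0, b - a] k ->
  measurable_fun (triangle a b)
    (fun p => x p.1 * (k (p.1 - p.2) * y p.2)).
Proof.
move=> mx my mk.
apply: measurable_funM; [|apply: measurable_funM].
- apply: (measurable_comp (F := `[a, b])) mx _ => //;
    last exact: measurable_funTS measurable_fst.
  move=> _ [[t s] [/= as_ st tb] <-]; rewrite /= in_itv/= tb andbT.
  exact: le_trans st.
- apply: (measurable_comp (F := `[0, b - a]) (g := (fun p : R * R => p.1 - p.2))) mk _ => //.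
    move=> _ [[t s] [/= as_ st tb] <-]; rewrite /= in_itv/= subr_ge0 st.
    exact: lerB.
  by apply: measurable_funB; apply: measurable_funTS.
- apply: (measurable_comp (F := `[a, b])) my _ => //;
    last exact: measurable_funTS measurable_snd.
  move=> _ [[t s] [/= as_ st tb] <-]; rewrite /= in_itv/= as_.
  exact: le_trans tb.
Qed.

(** Provides on every row, not just almost every one, the measurability required to move the factor
    [x t] across the inner integral. *)
Lemma measurable_fun_left_section y k t : t \in `[a, b] ->
  measurable_fun `[a, b] y -> measurable_fun `[0, b - a] k ->
  measurable_fun `[a, t] (fun s => k (t - s) * y s).
Proof.
rewrite in_itv/= => /andP[at_ tb] my mk; apply: measurable_funM.
  apply: (measurable_comp (F := `[0, b - a]) (g := (fun s : R => t - s))) mk _ => //.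
    move=> _ [s /= + <-]; rewrite !in_itv/= subr_ge0 => /andP[as_ ->].
    exact: lerB.
  by apply: measurable_funB.
apply: measurable_funS my => // s /=; rewrite !in_itv/= => /andP[-> st].
exact: le_trans tb.
Qed.

Lemma measurable_fun_right_section x k s : s \in `[a, b] ->
  measurable_fun `[a, b] x -> measurable_fun `[0, b - a] k ->
  measurable_fun `[s, b] (fun t => k (t - s) * x t).
Proof.
rewrite in_itv/= => /andP[as_ sb] mx mk; apply: measurable_funM.
  apply: (measurable_comp (F := `[0, b - a]) (g := (fun t : R => t - s))) mk _ => //.
    move=> _ [t /= + <-]; rewrite !in_itv/= subr_ge0 => /andP[-> tb].
    exact: lerB.
  by apply: measurable_funB.
apply: measurable_funS mx => // t /=; rewrite !in_itv/= => /andP[st ->].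
by rewrite andbT; exact: le_trans st.
Qed.

Lemma mem_triangle_row t s :
  ((t, s) \in triangle a b) = (t \in `[a, b]) && (s \in `[a, t]).
Proof.
rewrite !in_itv/=; apply/idP/idP => [|/andP[/andP[? ?] /andP[? ?]]].
  rewrite inE => -[/= as_ st ->]; rewrite as_ st !andbT.
  exact: le_trans st.
by rewrite inE.
Qed.

Lemma mem_triangle_col t s :
  ((t, s) \in triangle a b) = (s \in `[a, b]) && (t \in `[s, b]).
Proof.
rewrite !in_itv/=; apply/idP/idP => [|/andP[/andP[? ?] /andP[? ?]]].
  rewrite inE => -[/= -> st tb]; rewrite tb st !andbT.
  exact: le_trans tb.
by rewrite inE.
Qed.

(** Extension by zero trades an inner domain that varies with t for the whole line, the form in
    which the product measure and Fubini apply. *)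
Lemma integral_triangle (f : R * R -> \bar R) :
  (\int[mu]_(t in `[a, b]) \int[mu]_(s in `[a, t]) f (t, s) =
   \int[mu]_t \int[mu]_s (f \_ (triangle a b)) (t, s))%E.
Proof.
rewrite integral_mkcond; apply: eq_integral => t _; rewrite patchE mem_setE.
case: ifPn => tab.
  rewrite integral_mkcond; apply: eq_integral => s _.
  by rewrite !patchE mem_triangle_row tab mem_setE.
rewrite integral0_eq// => s _.
by rewrite patchE mem_triangle_row (negbTE tab).
Qed.

Lemma Rintegral_triangle_row (f : R * R -> R) :
  \int[mu]_(t in `[a, b]) \int[mu]_(s in `[a, t]) f (t, s) =
  \int[mu]_t \int[mu]_s (f \_ (triangle a b)) (t, s).
Proof.
rewrite Rintegral_mkcond; apply: eq_Rintegral => t _; rewrite patchE mem_setE.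
case: ifPn => tab.
  rewrite Rintegral_mkcond; apply: eq_Rintegral => s _.
  by rewrite !patchE mem_triangle_row tab mem_setE.
rewrite /Rintegral integral0_eq// => s _.
by rewrite patchE mem_triangle_row (negbTE tab).
Qed.

Lemma Rintegral_triangle_col (f : R * R -> R) :
  \int[mu]_(s in `[a, b]) \int[mu]_(t in `[s, b]) f (t, s) =
  \int[mu]_s \int[mu]_t (f \_ (triangle a b)) (t, s).
Proof.
rewrite Rintegral_mkcond; apply: eq_Rintegral => s _; rewrite patchE mem_setE.
case: ifPn => sab.
  rewrite Rintegral_mkcond; apply: eq_Rintegral => t _.
  by rewrite !patchE mem_triangle_col sab mem_setE.
rewrite /Rintegral integral0_eq// => t _.
by rewrite patchE mem_triangle_col (negbTE sab).
Qed.

(* Tonelli turns absolute convergence for a majorant [h] of the kernel [k]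
   into integrability on the triangle, where Fubini applies. *)
Lemma real_kernel_duality x y k (h : R -> R) :
  measurable_fun `[a, b] x -> measurable_fun `[a, b] y ->
  measurable_fun `[0, b - a] k -> measurable_fun `[0, b - a] h ->
  (forall u, u \in `[0, b - a] -> `|k u| <= `|h u|) ->
  (\int[mu]_(t in `[a, b]) \int[mu]_(s in `[a, t])
     `|x t * (h (t - s) * y s)|%:E < +oo)%E ->
  \int[mu]_(t in `[a, b]) (x t * \int[mu]_(s in `[a, t]) (k (t - s) * y s)) =
  \int[mu]_(s in `[a, b]) (y s * \int[mu]_(t in `[s, b]) (k (t - s) * x t)).
Proof.
move=> mx my mk mh kh hoo.
(* The kernel is left as a parameter: [F h] carries the absolute convergence, [F k] is the function
   to be integrated in both orders. *)
pose F j (p : R * R) := x p.1 * (j (p.1 - p.2) * y p.2).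
have mF j : measurable_fun `[0, b - a] j ->
    measurable_fun setT (fun p => ((F j \_ (triangle a b)) p)%:E).
  move=> mj; apply/measurable_EFinP/(measurable_restrictT _ measurable_triangle).
  exact: measurable_fun_kernel_triangle.
have hi : (mu \x mu)%E.-integrable setT (EFin \o (F h \_ (triangle a b))).
  apply/integrable12ltyP; first exact: mF.
  rewrite (integral_triangle (fun p => `|F h p|%:E)) in hoo.
  rewrite (le_lt_trans _ hoo)// le_eqVlt; apply/orP; left; apply/eqP.
  apply: eq_integral => t _; apply: eq_integral => s _ /=.
  by rewrite !patchE; case: ifPn => //= _; rewrite normr0.
(* On the triangle t - s lies in [0, b - a], so [F k] is dominated by [F h]; off it both extensions
   vanish. *)
have ki : (mu \x mu)%E.-integrable setT (EFin \o (F k \_ (triangle a b))).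
  apply: le_integrable hi => //; first exact: mF.
  move=> [t s] _ /=; rewrite !patchE; case: ifPn => //.
  rewrite inE => -[/= as_ st tb]; rewrite lee_fin !normrM ler_wpM2l// ler_wpM2r//.
  by apply: kh; rewrite in_itv/= subr_ge0 st lerB.
(* [x t] enters the inner integral so that the order can be exchanged; [y s] leaves it afterwards in
   the same way. *)
transitivity (\int[mu]_(t in `[a, b]) \int[mu]_(s in `[a, t]) F k (t, s)).
  apply: eq_Rintegral => t; rewrite mem_setE => tab.
  by rewrite -RintegralZl_measurable//; exact: measurable_fun_left_section.
rewrite Rintegral_triangle_row Rintegral_fubini// -Rintegral_triangle_col.
apply: eq_Rintegral => s; rewrite mem_setE => sab.
rewrite -RintegralZl_measurable//; last exact: measurable_fun_right_section.
by apply: eq_Rintegral => t _; rewrite /F/= mulrA mulrC (mulrC (x t)).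
Qed.

End triangle.

(** * Convergence of the power series and measurability of complex-valued functions *)

Lemma power_series_cvg (K : numFieldType) (rho : K) (c : nat -> K) (A : K -> K)
    (z e : K) : power_series_on_disc rho c A -> `|z| < rho -> 0 < e ->
  \forall n \near \oo, `|A z - \sum_(0 <= k < n) c k * z ^+ k| < e.
Proof.
move=> hA /hA[V Vz cV] e0.
(* The functions within e of A throughout V form a neighbourhood of A for uniform convergence on V;
   evaluating at z, which lies in V, gives the claim. *)
have : nbhs (A : {uniform` V -> K})
    [set h : K -> K | forall w, V w -> `|A w - h w| < e].
  apply/uniform_nbhs; exists [set p : K * K | ball p.1 e p.2]; split.
    exact: (entourage_ball _ (PosNum e0)).
  by move=> h /= hh w /hh; rewrite -ball_normE.
move=> /cV H; have : (\forall n \near \oo, forall w, V w ->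
  `|A w - \sum_(0 <= k < n) c k * w ^+ k| < e) by exact: H.
by apply: filterS => n /(_ z (nbhs_singleton Vz)).
Qed.

Section complex_measurability.
Context d (T : measurableType d) (R : realType) (D : set T).
Implicit Types f g : T -> R[i].

(** Stated by components to match [Cintegral], which integrates real and imaginary parts
    separately. *)
Definition cmeasurable_fun f :=
  measurable_fun D (fun t => complex.Re (f t)) /\
  measurable_fun D (fun t => complex.Im (f t)).

Lemma cmeasurable_cst z : cmeasurable_fun (cst z).
Proof. by split; exact: measurable_cst. Qed.

Lemma cmeasurable_funD f g : cmeasurable_fun f -> cmeasurable_fun g ->
  cmeasurable_fun (fun t => f t + g t).
Proof.
move=> [rf jf] [rg jg]; split.
  by under eq_fun do rewrite raddfD; exact: measurable_funD.
by under eq_fun do rewrite raddfD; exact: measurable_funD.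
Qed.

Lemma cmeasurable_funM f g : cmeasurable_fun f -> cmeasurable_fun g ->
  cmeasurable_fun (fun t => f t * g t).
Proof.
have ReM (z w : R[i]) : complex.Re (z * w) =
  complex.Re z * complex.Re w - complex.Im z * complex.Im w.
  by case: z w => [? ?] [].
have ImM (z w : R[i]) : complex.Im (z * w) =
  complex.Re z * complex.Im w + complex.Im z * complex.Re w.
  by case: z w => [? ?] [].
move=> [rf jf] [rg jg]; split.
  by under eq_fun do rewrite ReM; apply: measurable_funB; exact: measurable_funM.
by under eq_fun do rewrite ImM; apply: measurable_funD; exact: measurable_funM.
Qed.

Lemma cmeasurable_fun_sum (s : seq nat) (h : nat -> T -> R[i]) :
  (forall n, cmeasurable_fun (h n)) ->
  cmeasurable_fun (fun t => \sum_(k <- s) h k t).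
Proof.
move=> mh; elim: s => [|n s ih].
  by under eq_fun do rewrite big_nil; exact: cmeasurable_cst.
by under eq_fun do rewrite big_cons; exact: cmeasurable_funD.
Qed.

Lemma cmeasurable_funX f n : cmeasurable_fun f ->
  cmeasurable_fun (fun t => f t ^+ n).
Proof.
move=> mf; elim: n => [|n ih].
  by under eq_fun do rewrite expr0; exact: cmeasurable_cst.
by under eq_fun do rewrite exprS; exact: cmeasurable_funM.
Qed.

(** Since |Re z| and |Im z| are at most |z|, both components converge pointwise, and a pointwise
    limit of real measurable functions is measurable. The norm on [R[i]] is complex-valued, whence
    [e%:C]. *)
Lemma cmeasurable_fun_cvg (h : nat -> T -> R[i]) f :
  (forall n, cmeasurable_fun (h n)) ->
  (forall t (e : R), D t -> 0 < e ->
    \forall n \near \oo, `|f t - h n t| < e%:C) ->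
  cmeasurable_fun f.
Proof.
have Im_le (z : R[i]) : `|complex.Im z|%:C <= `|z|.
  by rewrite normc_def lecR -sqrtr_sqr ler_wsqrtr// lerDr sqr_ge0.
move=> mh hf; split.
- apply: (measurable_fun_cvg (h := fun n t => complex.Re (h n t))) => [n|t Dt].
    exact: (mh n).1.
  apply/cvgrPdist_lt => e e0.
  apply: filterS (hf t e Dt e0) => n.
  by rewrite -raddfB -ltcR; apply: le_lt_trans; exact: normc_ge_Re.
- apply: (measurable_fun_cvg (h := fun n t => complex.Im (h n t))) => [n|t Dt].
    exact: (mh n).2.
  apply/cvgrPdist_lt => e e0.
  apply: filterS (hf t e Dt e0) => n.
  by rewrite -raddfB -ltcR; apply: le_lt_trans; exact: Im_le.
Qed.

(** The real-valued modulus of the kernel will serve as the majorant of its components. *)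
Lemma measurable_fun_normc f : cmeasurable_fun f ->
  measurable_fun D (fun t => ComplexField.Normc.normc (f t)).
Proof.
move=> [rf jf].
rewrite (_ : (fun t => _) =
  Num.sqrt \o (fun t => complex.Re (f t) ^+ 2 + complex.Im (f t) ^+ 2)).
  apply: measurableT_comp; last by apply: measurable_funD; exact: measurable_funX.
  by apply: continuous_measurable_fun; exact: sqrt_continuous.
by apply/funext => t /=; case: (f t).
Qed.

End complex_measurability.

(** * Measurability of the analytic kernel *)

Section kernel.
Context (R : realType).
Implicit Types (beta : R[i]) (A : R[i] -> R[i]).

(** The trigonometric factor has modulus 1 whatever real value [ln u] takes, so the formula holds
    for u <= 0 too. *)
Lemma norm_cpowR (u : R) beta : `|cpowR u beta| = (u `^ complex.Re beta)%:C.
Proof.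
rewrite normrM [X in _ * X]normc_def /= cos2Dsin2 sqrtr1 mulr1.
by rewrite normc_def /= expr0n addr0 sqrtr_sqr ger0_norm// powR_ge0.
Qed.

Lemma cmeasurable_cpowR (D : set R) beta : 
  cmeasurable_fun D (fun u => cpowR u beta).
Proof.
apply: cmeasurable_funM; split => /=.
- by apply: measurable_funTS; exact: measurable_powR.
- exact: measurable_cst.
- apply: measurable_funTS; apply: measurableT_comp.
    by apply: continuous_measurable_fun; exact: continuous_cos.
  by apply: measurable_funM => //; exact: measurable_ln.
- apply: measurable_funTS; apply: measurableT_comp.
    by apply: continuous_measurable_fun; exact: continuous_sin.
  by apply: measurable_funM => //; exact: measurable_ln.
Qed.

Lemma cmeasurable_analytic_kernel (alpha rho l : R) beta (c : nat -> R[i]) A :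
  0 <= complex.Re beta -> l `^ complex.Re beta < rho ->
  power_series_on_disc rho%:C c A ->
  cmeasurable_fun `[0, l] (analytic_kernel alpha beta A).
Proof.
move=> beta0 lrho hA; apply: cmeasurable_funM.
  split => /=; last exact: measurable_cst.
  by apply: measurable_funTS; exact: measurable_powR.
apply: (cmeasurable_fun_cvg
  (h := fun n u => \sum_(0 <= k < n) c k * cpowR u beta ^+ k)).
  move=> n; apply: cmeasurable_fun_sum => k.
  apply: cmeasurable_funM; first exact: cmeasurable_cst.
  by apply: cmeasurable_funX; exact: cmeasurable_cpowR.
move=> u e /=; rewrite in_itv/= => /andP[u0 ul] e0.
apply: (power_series_cvg hA); last by rewrite ltcR.
(* A power with non-negative exponent is monotone, so on all of [0, l], endpoint 0 included, the
   argument of A stays in the disc. *)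
rewrite norm_cpowR ltcR (le_lt_trans _ lrho)//.
by apply: ge0_ler_powR; rewrite // nnegrE (le_trans u0 ul).
Qed.

End kernel.

(** * The duality relation, by real and imaginary parts *)

Theorem lemma9 (R : realType) (a b alpha rho : R) (beta : R[i])
    (c : nat -> R[i]) (A : R[i] -> R[i])
    (hab : a < b)
    (halpha : 0 <= alpha <= 1)
    (hbeta : 0 <= complex.Re beta)
    (hrho0 : 0 < rho)
    (hrho : (b - a) `^ complex.Re beta < rho)
    (hA : power_series_on_disc rho%:C c A)
    (x y : R -> R)
    (hx : lebesgue_measure.-integrable `[a, b] (EFin \o x))
    (hy : lebesgue_measure.-integrable `[a, b] (EFin \o y))
    (hxy : left_pairing_defined a b alpha beta A x y)
    (hyx : right_pairing_defined a b alpha beta A x y) :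
  Cintegral `[a, b]
    (fun t => (x t)%:C * left_frac_integral a alpha beta A y t)
  = Cintegral `[a, b]
    (fun t => (y t)%:C * right_frac_integral b alpha beta A x t).
Proof.
have /measurable_EFinP mx := measurable_int _ hx.
have /measurable_EFinP my := measurable_int _ hy.
have mK := cmeasurable_analytic_kernel alpha hbeta hrho hA.
have mN := measurable_fun_normc mK.
(* By multiplicativity of the modulus, the absolute convergence takes the form of
   [real_kernel_duality] with the modulus of the kernel as [h]. *)
have {hxy} Kxy : (\int[lebesgue_measure]_(t in `[a, b])
    \int[lebesgue_measure]_(s in `[a, t]) `|x t *
      (ComplexField.Normc.normc (analytic_kernel alpha beta A (t - s)) * y s)|%:E
    < +oo)%E.
  have normc_ge0 (z : R[i]) : 0 <= ComplexField.Normc.normc z.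
    by case: z => ? ?; exact: sqrtr_ge0.
  have normcR (r : R) : ComplexField.Normc.normc r%:C = `|r|.
    by rewrite /= expr0n addr0 sqrtr_sqr.
  apply: le_lt_trans hxy; rewrite le_eqVlt; apply/orP; left; apply/eqP.
  apply: eq_integral => t _; apply: eq_integral => s _.
  move: (analytic_kernel _ _ _ _) => k.
  by rewrite !ComplexField.Normc.normcM !normcR !normrM (ger0_norm (normc_ge0 _)).
(* P stands for Re or Im. Both commute with [Cintegral] and with real factors and are bounded by the
   modulus, so the single majorant serves both. *)
have dual (P : R[i] -> R) :
    (forall D f, P (Cintegral D f) =
      \int[@lebesgue_measure R]_(t in D) P (f t)) ->
    (forall (r : R) z, P (r%:C * z) = r * P z) ->
    (forall z, `|P z| <= `|ComplexField.Normc.normc z|) ->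
    measurable_fun `[0, b - a] (fun u => P (analytic_kernel alpha beta A u)) ->
    P (Cintegral `[a, b]
      (fun t => (x t)%:C * left_frac_integral a alpha beta A y t)) =
    P (Cintegral `[a, b]
      (fun t => (y t)%:C * right_frac_integral b alpha beta A x t)).
  move=> PI PZ Ple mP; rewrite !PI.
  have PZr z (r : R) : P (z * r%:C) = P z * r by rewrite mulrC PZ mulrC.
  under eq_Rintegral => t _.
    rewrite PZ PI; under eq_Rintegral do rewrite PZr.
    over.
  rewrite (real_kernel_duality mx my mP mN (fun u _ => Ple _) Kxy).
  apply: eq_Rintegral => t _; rewrite PZ PI; congr (_ * _).
  by apply: eq_Rintegral => s _; rewrite PZr.
have complex_ext (z w : R[i]) :
    complex.Re z = complex.Re w -> complex.Im z = complex.Im w -> z = w.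
  by case: z w => [? ?] [? ?] /= -> ->.
apply: complex_ext.
- apply: (dual (@complex.Re R)) mK.1 => //.
    by move=> r [p q] /=; rewrite mul0r subr0.
  case=> p q; rewrite /= -sqrtr_sqr ger0_norm ?sqrtr_ge0// ler_wsqrtr//.
  by rewrite lerDl sqr_ge0.
- apply: (dual (@complex.Im R)) mK.2 => //.
    by move=> r [p q] /=; rewrite mul0r addr0.
  case=> p q; rewrite /= -sqrtr_sqr ger0_norm ?sqrtr_ge0// ler_wsqrtr//.
  by rewrite lerDr sqr_ge0.
Qed.
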